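(* Let $\mu$ be a positive finite Borel measure on $[0,1)$. The following are equivalent: (i) $H_\mu:H^\infty\to H^\infty$ is (well defined and) continuous; (ii) $H_\mu:H^\infty\to H^\infty$ is compact; (iii) $\int_0^1\frac{d\mu(t)}{1-t}<\infty$; (iv) $\sum_{n=0}^\infty\mu_n<\infty$; (v) $H_\mu:A(\mathbb{D})\to A(\mathbb{D})$ is (well defined and) continuous; (vi) $H_\mu:A(\mathbb{D})\to A(\mathbb{D})$ is compact. If these assertions hold, then $H_\mu=I_\mu$ on $H^\infty$.
   Context: $\mathbb{D}$ is the open unit disc, $H(\mathbb{D})$ the holomorphic functions on $\mathbb{D}$, $H^\infty$ the Banach space of bounded holomorphic functions on $\mathbb{D}$ with the sup norm, and $A(\mathbb{D})$ the disc algebra (functions continuous on $\overline{\mathbb{D}}$ and holomorphic on $\mathbb{D}$) with the sup norm. For a positive finite Borel measure $\mu$ on $[0,1)$, $\mu_n=\int_0^1t^n\,d\mu(t)$. For $f(z)=\sum_{n\ge0}a_nz^n\in H(\mathbb{D})$, $H_\mu(f)(z)=\sum_{n=0}^\infty\left(\sum_{k=0}^\infty\mu_{n+k}a_k\right)z^n$ whenever this defines a holomorphic function on $\mathbb{D}$, and $I_\mu(f)(z)=\int_0^1\frac{f(t)}{1-tz}\,d\mu(t)$ whenever this defines a holomorphic function on $\mathbb{D}$. *)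

(* Defs.v *)
From HB Require Import structures.
From mathcomp Require Import all_boot all_order all_algebra.
From mathcomp Require Import all_classical all_reals all_analysis.
From mathcomp Require Import complex.
Set Implicit Arguments.
Unset Strict Implicit.
Unset Printing Implicit Defensive.
Import Order.TTheory GRing.Theory Num.Theory.
Import numFieldNormedType.Exports.
Local Open Scope classical_set_scope.
Local Open Scope ring_scope.
Local Open Scope complex_scope.

Definition cmod {R : realType} (z : R[i]) : R :=
  Num.sqrt (complex.Re z ^+ 2 + complex.Im z ^+ 2).

Definition ccvg {R : realType} (u : nat -> R[i]) (l : R[i]) : Prop :=
  (fun n => cmod (u n - l)) @ \oo --> (0 : R).

Definition disc {R : realType} : set R[i] := [set z | cmod z < 1].
Definition cdisc {R : realType} : set R[i] := [set z | cmod z <= 1].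

Definition taylor {R : realType} (a : nat -> R[i]) (f : R[i] -> R[i]) : Prop :=
  forall z, z \in disc -> ccvg (fun N => \sum_(k < N) a k * z ^+ k) (f z).

(* f is holomorphic on D (i.e. given on D by a power series centred at 0) *)
Definition holD {R : realType} (f : R[i] -> R[i]) : Prop :=
  exists a, taylor a f.

Definition Hinf {R : realType} (f : R[i] -> R[i]) : Prop :=
  holD f /\ exists M : R, forall z, z \in disc -> cmod (f z) <= M.

Definition supD {R : realType} (f : R[i] -> R[i]) : R :=
  sup [set cmod (f z) | z in disc].

Definition contCD {R : realType} (f : R[i] -> R[i]) : Prop :=
  forall z, z \in cdisc -> forall e : R, 0 < e -> exists d : R, 0 < d /\
    forall w, w \in cdisc -> cmod (w - z) < d -> cmod (f w - f z) < e.

Definition AD {R : realType} (f : R[i] -> R[i]) : Prop := holD f /\ contCD f.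

Definition supCD {R : realType} (f : R[i] -> R[i]) : R :=
  sup [set cmod (f z) | z in cdisc].

Definition fsub {R : realType} (f g : R[i] -> R[i]) : R[i] -> R[i] :=
  fun z => f z - g z.

Definition Rmeas (R : realType) := {finite_measure set (measurableTypeR R) -> \bar R}.

Definition moment {R : realType} (mu : Rmeas R) (n : nat) : R :=
  Rintegral mu `[0, 1[%classic (fun t => t ^+ n).

Definition HmuRel {R : realType} (mu : Rmeas R) (f g : R[i] -> R[i]) : Prop :=
  exists a b : nat -> R[i], [/\ taylor a f,
    (forall n, ccvg (fun N => \sum_(k < N) (moment mu (n + k))%:C * a k) (b n))
    & taylor b g].

Definition Hmu_Hinf_cont {R : realType} (mu : Rmeas R) : Prop :=
  (forall f, Hinf f -> exists g, HmuRel mu f g /\ Hinf g) /\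
  (forall f (e : R), Hinf f -> 0 < e -> exists d : R, 0 < d /\
     forall f' g g', Hinf f' -> HmuRel mu f g -> HmuRel mu f' g' ->
       supD (fsub f' f) < d -> supD (fsub g' g) < e).

Definition Hmu_Hinf_compact {R : realType} (mu : Rmeas R) : Prop :=
  (forall f, Hinf f -> exists g, HmuRel mu f g /\ Hinf g) /\
  (forall F G : nat -> R[i] -> R[i],
     (forall k, [/\ Hinf (F k), supD (F k) <= 1 & HmuRel mu (F k) (G k)]) ->
     exists (phi : nat -> nat) (g : R[i] -> R[i]),
       [/\ (forall k, (phi k < phi k.+1)%N), Hinf g &
           (fun k => supD (fsub (G (phi k)) g)) @ \oo --> (0 : R)]).

Definition Hmu_AD_cont {R : realType} (mu : Rmeas R) : Prop :=
  (forall f, AD f -> exists g, HmuRel mu f g /\ AD g) /\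
  (forall f (e : R), AD f -> 0 < e -> exists d : R, 0 < d /\
     forall f' g g', AD f' -> AD g -> AD g' -> HmuRel mu f g -> HmuRel mu f' g' ->
       supCD (fsub f' f) < d -> supCD (fsub g' g) < e).

Definition Hmu_AD_compact {R : realType} (mu : Rmeas R) : Prop :=
  (forall f, AD f -> exists g, HmuRel mu f g /\ AD g) /\
  (forall F G : nat -> R[i] -> R[i],
     (forall k, [/\ AD (F k), supCD (F k) <= 1, HmuRel mu (F k) (G k) & AD (G k)]) ->
     exists (phi : nat -> nat) (g : R[i] -> R[i]),
       [/\ (forall k, (phi k < phi k.+1)%N), AD g &
           (fun k => supCD (fsub (G (phi k)) g)) @ \oo --> (0 : R)]).

Definition cintegrable {R : realType} (mu : Rmeas R) (h : R -> R[i]) : Prop :=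
  mu.-integrable `[0, 1[%classic (fun t => (complex.Re (h t))%:E) /\
  mu.-integrable `[0, 1[%classic (fun t => (complex.Im (h t))%:E).

Definition cintegral {R : realType} (mu : Rmeas R) (h : R -> R[i]) : R[i] :=
  (Rintegral mu `[0, 1[%classic (fun t => complex.Re (h t)))%:C +
  'i * (Rintegral mu `[0, 1[%classic (fun t => complex.Im (h t)))%:C.

Definition Hmu_eq_Imu {R : realType} (mu : Rmeas R) : Prop :=
  forall f g, Hinf f -> HmuRel mu f g -> forall z, z \in disc ->
    cintegrable mu (fun t => f t%:C / (1 - t%:C * z)) /\
    g z = cintegral mu (fun t => f t%:C / (1 - t%:C * z)).

(* Main.v *)
(** The key point is that finiteness of [int d mu / (1 - t)], equivalently of
    [sum mu_n], makes H_mu act through an absolutely summable sequence of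
    coefficients.  If [|f| <= M] on the disc, Cauchy's estimate bounds the
    Taylor coefficients of [f] by [M], so its partial sums on [[0, 1)] are
    dominated by [M / (1 - t)] and dominated convergence identifies the [n]-th
    coefficient of [H_mu f] with [int t^n f(t) d mu], which is at most
    [2 M mu_n] (the factor 2 comes from integrating real and imaginary parts
    separately).  Hence [H_mu f] lies in the disc algebra with norm at most
    [2 M sum mu_n], and compactness reduces to the fact that sequences
    dominated by a fixed summable sequence are relatively compact in l^1.
    Conversely [H_mu 1 = sum mu_n z^n], whose boundedness on [[0, 1)] forces
    [sum mu_n < oo]. *)
Require Import Defs.
From HB Require Import structures.
From mathcomp Require Import all_boot all_order all_algebra.
From mathcomp Require Import all_classical all_reals all_analysis.
From mathcomp Require Import complex measurable_realfun ring lra.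
Import Order.TTheory GRing.Theory Num.Theory.
Import numFieldNormedType.Exports.
Local Open Scope classical_set_scope.
Local Open Scope ring_scope.
Local Open Scope complex_scope.
Set Implicit Arguments.
Unset Strict Implicit.
Unset Printing Implicit Defensive.

(** * Modulus and convergence of complex sequences *)

Lemma cmodE (R : realType) (z : R[i]) : cmod z = Normc.normc z.
Proof. by case: z. Qed.

Lemma cmod_ge0 (R : realType) (z : R[i]) : 0 <= cmod z.
Proof. exact: sqrtr_ge0. Qed.

Lemma cmod0 (R : realType) : cmod (0 : R[i]) = 0.
Proof. by rewrite cmodE Normc.normc0. Qed.

Lemma cmod1 (R : realType) : cmod (1 : R[i]) = 1.
Proof. by rewrite cmodE Normc.normc1. Qed.

Lemma cmod_eq0 (R : realType) (z : R[i]) : cmod z = 0 -> z = 0.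
Proof. by rewrite cmodE => /Normc.eq0_normc. Qed.

Lemma cmodM (R : realType) (z w : R[i]) : cmod (z * w) = cmod z * cmod w.
Proof. by rewrite !cmodE Normc.normcM. Qed.

Lemma cmodX (R : realType) (z : R[i]) n : cmod (z ^+ n) = cmod z ^+ n.
Proof. by elim: n => [|n IH]; rewrite ?expr0 ?cmod1// !exprS cmodM IH. Qed.

Lemma cmodN (R : realType) (z : R[i]) : cmod (- z) = cmod z.
Proof. by rewrite !cmodE normcN. Qed.

Lemma cmodD (R : realType) (z w : R[i]) : cmod (z + w) <= cmod z + cmod w.
Proof. by rewrite !cmodE le_normcD. Qed.

Lemma cmodB (R : realType) (z w : R[i]) : cmod (z - w) <= cmod z + cmod w.
Proof. by rewrite -(cmodN w) cmodD. Qed.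

Lemma cmod_distC (R : realType) (z w : R[i]) : cmod (z - w) = cmod (w - z).
Proof. by rewrite -cmodN opprB. Qed.

Lemma cmod_real (R : realType) (x : R) : cmod x%:C = `|x|.
Proof. by rewrite /cmod /= expr0n addr0 sqrtr_sqr. Qed.

Lemma cmod_sum (R : realType) (I : Type) (s : seq I) (P : pred I) (F : I -> R[i]) :
  cmod (\sum_(i <- s | P i) F i) <= \sum_(i <- s | P i) cmod (F i).
Proof.
elim/big_rec2: _ => [|i x y _ IH]; first by rewrite cmod0.
by rewrite (le_trans (cmodD _ _))// lerD2l.
Qed.

Lemma Re_le_cmod (R : realType) (z : R[i]) : `|complex.Re z| <= cmod z.
Proof. by rewrite -sqrtr_sqr ler_wsqrtr// lerDl sqr_ge0. Qed.

Lemma Im_le_cmod (R : realType) (z : R[i]) : `|complex.Im z| <= cmod z.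
Proof. by rewrite -sqrtr_sqr ler_wsqrtr// lerDr sqr_ge0. Qed.

Lemma cmod_le_ReIm (R : realType) (z : R[i]) :
  cmod z <= `|complex.Re z| + `|complex.Im z|.
Proof.
rewrite {1}(complexE z) (le_trans (cmodD _ _))// cmodM !cmod_real.
by rewrite {1}/cmod /= expr0n expr1n add0r sqrtr1 mul1r.
Qed.

Lemma ReB (R : realType) (z w : R[i]) :
  complex.Re (z - w) = complex.Re z - complex.Re w.
Proof. by case: z; case: w. Qed.

Lemma ImB (R : realType) (z w : R[i]) :
  complex.Im (z - w) = complex.Im z - complex.Im w.
Proof. by case: z; case: w. Qed.

Lemma ccvgP (R : realType) (u : nat -> R[i]) (l : R[i]) :
  ccvg u l <-> forall e : R, 0 < e ->
    exists N, forall n, (N <= n)%N -> cmod (u n - l) < e.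
Proof.
split=> [/cvgr0Pnorm_lt H e /H[N _ HN]|H].
  by exists N => n /HN; rewrite /= ger0_norm ?cmod_ge0.
apply/cvgr0Pnorm_lt => e /H[N HN]; exists N => // n /HN.
by rewrite /= ger0_norm ?cmod_ge0.
Qed.

Lemma ccvg_ReIm (R : realType) (u : nat -> R[i]) (l : R[i]) :
  ccvg u l <-> (fun n => complex.Re (u n)) @ \oo --> complex.Re l /\
               (fun n => complex.Im (u n)) @ \oo --> complex.Im l.
Proof.
split=> [/ccvgP H|[/cvgrPdist_lt Hr /cvgrPdist_lt Hi]].
  split; apply/cvgrPdist_lt => e /H[N HN]; exists N => // n /HN /=.
    by apply: le_lt_trans; rewrite -ReB cmod_distC Re_le_cmod.
  by apply: le_lt_trans; rewrite -ImB cmod_distC Im_le_cmod.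
apply/ccvgP => e e0; have e2 : 0 < e / 2 by rewrite divr_gt0.
have [N _ HN] := Hr _ e2; have [M _ HM] := Hi _ e2.
exists (maxn N M) => n; rewrite geq_max => /andP[/HN /= h1 /HM /= h2].
rewrite cmod_distC (le_lt_trans (cmod_le_ReIm _))// ReB ImB.
by rewrite (splitr e) ltrD.
Qed.

Lemma ccvg_unique (R : realType) (u : nat -> R[i]) (l l' : R[i]) :
  ccvg u l -> ccvg u l' -> l = l'.
Proof.
move=> /ccvg_ReIm[h1 h2] /ccvg_ReIm[h3 h4].
have e1 := @cvg_unique _ (@Rhausdorff R) _ _ _ _ h1 h3.
have e2 := @cvg_unique _ (@Rhausdorff R) _ _ _ _ h2 h4.
by case: l l' e1 e2 {h1 h2 h3 h4} => a b [c d] /= -> ->.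
Qed.

Lemma ccvg_cst (R : realType) (l : R[i]) : ccvg (fun=> l) l.
Proof. by apply/ccvgP => e e0; exists 0%N => n _; rewrite subrr cmod0. Qed.

Lemma ccvgD (R : realType) (u v : nat -> R[i]) (l m : R[i]) :
  ccvg u l -> ccvg v m -> ccvg (fun n => u n + v n) (l + m).
Proof.
move=> /ccvgP Hu /ccvgP Hv; apply/ccvgP => e e0.
have e2 : 0 < e / 2 by rewrite divr_gt0.
have [N HN] := Hu _ e2; have [M HM] := Hv _ e2.
exists (maxn N M) => n; rewrite geq_max => /andP[/HN h1 /HM h2].
by rewrite opprD addrACA (le_lt_trans (cmodD _ _))// (splitr e) ltrD.
Qed.

Lemma ccvgZ (R : realType) (c : R[i]) (u : nat -> R[i]) (l : R[i]) :
  ccvg u l -> ccvg (fun n => c * u n) (c * l).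
Proof.
move=> /ccvgP H; apply/ccvgP => e e0.
have c0 : 0 < cmod c + 1 by rewrite ltr_wpDl ?cmod_ge0.
have [N HN] := H (e / (cmod c + 1)) (divr_gt0 e0 c0).
exists N => n /HN; rewrite ltr_pdivlMr// -mulrBr cmodM => h.
apply: le_lt_trans h; rewrite mulrC ler_wpM2l ?cmod_ge0// lerDl//.
Qed.

Lemma ccvgB (R : realType) (u v : nat -> R[i]) (l m : R[i]) :
  ccvg u l -> ccvg v m -> ccvg (fun n => u n - v n) (l - m).
Proof.
move=> Hu Hv; rewrite (_ : (fun _ => _) = (fun n => u n + (-1) * v n)).
  by rewrite -(mulN1r m); apply: ccvgD => //; apply: ccvgZ.
by apply/funext => n; rewrite mulN1r.
Qed.

Lemma ccvg_cmod_le (R : realType) (u : nat -> R[i]) (l : R[i]) (M : R) :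
  ccvg u l -> (exists N, forall n, (N <= n)%N -> cmod (u n) <= M) -> cmod l <= M.
Proof.
move=> /ccvgP H [N HN]; apply/ler_addgt0Pr => e /H[K HK].
have h1 := HN _ (leq_maxl N K); have h2 := HK _ (leq_maxr N K).
rewrite -(subrKC (u (maxn N K)) l).
by rewrite (le_trans (cmodD _ _))// lerD// cmod_distC ltW.
Qed.

Lemma discP (R : realType) (z : R[i]) : z \in disc <-> cmod z < 1.
Proof. by split; [rewrite inE|move=> ?; rewrite inE]. Qed.

Lemma cdiscP (R : realType) (z : R[i]) : z \in cdisc <-> cmod z <= 1.
Proof. by split; [rewrite inE|move=> ?; rewrite inE]. Qed.

Lemma disc_cdisc (R : realType) (z : R[i]) : z \in disc -> z \in cdisc.
Proof. by move=> /discP/ltW h; apply/cdiscP. Qed.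

Lemma disc0 (R : realType) : (0 : R[i]) \in disc.
Proof. by apply/discP; rewrite cmod0 ltr01. Qed.

(** * Cauchy's estimate *)

(** A solution of [w ^+ (2 ^ m) = -1] exists by algebraic closedness. Orders that are powers of two
    avoid any use of the complex exponential: the order of [w] divides [2 ^ m.+1], and a smaller one
    would give [w ^+ (2 ^ m) = 1]. *)
Lemma prim_root_2exp (R : realType) (m : nat) :
  exists w : R[i], (2 ^ m.+1).-primitive_root w /\ cmod w = 1.
Proof.
have [|w wE] := @solve_monicpoly R[i] (2 ^ m)%N (fun i => if i == 0%N then -1 else 0).
  by rewrite expn_gt0.
have {}wE : w ^+ (2 ^ m) = -1.
  rewrite wE -(prednK (_ : 0 < 2 ^ m)%N) ?expn_gt0// big_ord_recl/= big1.
    by rewrite addr0 expr0 mulr1.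
  by move=> i _; rewrite mul0r.
have w1 : w ^+ (2 ^ m.+1) = 1 by rewrite expnSr exprM wE sqrrN expr1n.
exists w; split; last first.
  apply/eqP; rewrite -(@pexpr_eq1 _ _ (2 ^ m.+1)) ?cmod_ge0 ?expn_gt0//.
  by rewrite -cmodX w1 cmod1.
have [|k prk] := @prim_order_exists _ (2 ^ m.+1)%N w _ w1.
  by rewrite expn_gt0.
move=> /(dvdn_pfactor _ _ (isT : prime 2))[j jm kE].
rewrite kE in prk; suff -> : m.+1 = j by [].
apply/eqP; rewrite eqn_leq jm andbT ltnNge; apply/negP => jlem.
have : w ^+ (2 ^ m) = 1.
  by apply/eqP; rewrite -(prim_order_dvd prk) dvdn_exp2l.
rewrite wE => /eqP; rewrite -subr_eq0 -opprD oppr_eq0.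
by rewrite -[1 + 1]/(2%:R) pnatr_eq0.
Qed.

(** This is a geometric sum whose ratio [w ^+ d] differs from 1 while its [N]-th power is 1. *)
Lemma sum_prim_root (F : fieldType) (N d : nat) (w : F) :
  N.-primitive_root w -> ~~ (N %| d)%N -> \sum_(j < N) w ^+ (j * d) = 0.
Proof.
move=> prw Nd; have /eqP : (w ^+ d) ^+ N - 1 = 0.
  by rewrite exprAC (prim_expr_order prw) expr1n subrr.
rewrite subrX1 mulf_eq0 subr_eq0 -(prim_order_dvd prw) (negbTE Nd) /=.
move=> /eqP e; rewrite -[RHS]e; apply: eq_bigr => j _.
by rewrite -exprM mulnC.
Qed.

(* Averaging over the [2 ^ m.+1]-th roots of unity isolates one coefficient. *)
Lemma cauchy_poly (R : realType) (a : nat -> R[i]) (m k : nat) (r M : R) :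
  (k < 2 ^ m.+1)%N -> 0 <= r ->
  (forall z, cmod z = r -> cmod (\sum_(i < 2 ^ m.+1) a i * z ^+ i) <= M) ->
  cmod (a k) * r ^+ k <= M.
Proof.
set N := (2 ^ m.+1)%N => kN r0 H.
have [w [prw w1]] := prim_root_2exp R m; rewrite -/N in prw.
have N0 : (0 < N)%N by rewrite expn_gt0.
(* The weight [w ^+ (j * (N - k))] stands for [w ^- (j * k)], so that all exponents stay natural
   numbers. *)
have E : \sum_(j < N) w ^+ (j * (N - k)) *
           (\sum_(i < N) a i * (r%:C * w ^+ j) ^+ i) = N%:R * (a k * r%:C ^+ k).
  under eq_bigr do rewrite big_distrr /=.
  rewrite exchange_big /= (bigD1 (Ordinal kN)) //= [X in _ + X]big1 ?addr0.
    rewrite -[N in N%:R]card_ord mulr_natl -sumr_const; apply: eq_bigr => j _ /=.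
    rewrite exprMn mulrC -!mulrA -exprM -exprD -mulnDr subnKC; last exact: ltnW.
    by rewrite mulnC exprM (prim_expr_order prw) expr1n mulr1.
  move=> i ik; transitivity
    (a i * r%:C ^+ i * \sum_(j < N) w ^+ (j * (i + (N - k)))).
    rewrite big_distrr /=; apply: eq_bigr => j _.
    by rewrite exprMn mulrC -!mulrA -exprM -exprD -mulnDr.
  rewrite (sum_prim_root prw) ?mulr0// addnBA; last exact: ltnW.
  rewrite addnC; apply: contra ik => /dvdnP[q qE].
  have iN := ltn_ord i.
  have : (N + i = q * N + k)%N by rewrite -qE subnK// ltnW// ltn_addr.
  (* From [N + i = q * N + k] with [i, k < N]: [q = 0] would give [N <= k], [q = 1] gives [i = k],
     and [q >= 2] would give [N <= i]. *)
  case: q qE => [|[|q]] qE e.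
  - have : (N <= k)%N by rewrite -[k]add0n -(mul0n N) -e leq_addr.
    by rewrite leqNgt kN.
  - by apply/eqP/val_inj => /=; move/eqP: e; rewrite mul1n eqn_add2l => /eqP.
  - move: e iN; rewrite !mulSn -addnA => /eqP; rewrite eqn_add2l => /eqP ->.
    by rewrite ltnNge -!addnA leq_addr.
have : cmod (N%:R * (a k * r%:C ^+ k)) <= N%:R * M.
  rewrite -E (le_trans (cmod_sum _ _ _))// mulr_natl -[N in M *+ N]card_ord.
  rewrite -sumr_const ler_sum// => j _; rewrite cmodM cmodX w1 expr1n mul1r.
  by apply: H; rewrite cmodM cmodX w1 expr1n mulr1 cmod_real ger0_norm.
rewrite !cmodM cmodX cmod_real ger0_norm// -(rmorph_nat (real_complex R)).
by rewrite cmod_real normr_nat ler_pM2l// ltr0n.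
Qed.

(** * Complex series with a summable majorant *)

Lemma series_tail (R : realType) (b : nat -> R[i]) (c : nat -> R) (N M : nat) :
  (forall n, cmod (b n) <= c n) -> (N <= M)%N ->
  cmod (\sum_(k < M) b k - \sum_(k < N) b k) <= series c M - series c N.
Proof.
move=> H NM; rewrite !seriesEnat /= -!(big_mkord xpredT b).
rewrite !(big_cat_nat (leq0n N) NM) /=.
rewrite [X in cmod X]addrAC [X in _ <= X]addrAC !subrr !add0r.
by rewrite (le_trans (cmod_sum _ _ _))// ler_sum.
Qed.

(** Real absolute convergence is applied to the two coordinates; [aux] handles both, as each is
    additive and bounded by the modulus. *)
Lemma abs_ccvg (R : realType) (b : nat -> R[i]) (c : nat -> R) :
  (forall n, cmod (b n) <= c n) -> cvgn (series c) ->
  exists s, ccvg (fun N => \sum_(k < N) b k) s.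
Proof.
move=> H cc.
have aux (g : R[i] -> R) : (forall z, `|g z| <= cmod z) -> g 0 = 0 ->
    {morph g : x y / x + y} ->
    exists l : R, (fun n => g (\sum_(k < n) b k)) @ \oo --> l.
  move=> gle g0 gD; exists (limn (series (fun n => g (b n)))).
  rewrite (_ : (fun n => _) = series (fun n => g (b n))).
    apply: normed_cvg; apply: (series_le_cvg _ _ _ cc) => n //=.
      exact: le_trans (cmod_ge0 _) (H n).
    exact: le_trans (gle _) (H n).
  apply/funext => n; rewrite seriesEord.
  exact: (big_morph g gD g0).
have [|||x Hx] := aux (@complex.Re R); first exact: Re_le_cmod.
- by [].
- by case=> a a' [].
have [|||y Hy] := aux (@complex.Im R); first exact: Im_le_cmod.
- by [].
- by case=> a a' [].
by exists (x +i* y); apply/ccvg_ReIm; split.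
Qed.

(** The bound depends only on the majorant [c], which makes later tail estimates uniform in the
    point and in the function. *)
Lemma abs_tail (R : realType) (b : nat -> R[i]) (c : nat -> R) (s : R[i]) :
  (forall n, cmod (b n) <= c n) -> cvgn (series c) ->
  ccvg (fun N => \sum_(k < N) b k) s ->
  forall N, cmod (s - \sum_(k < N) b k) <= limn (series c) - series c N.
Proof.
move=> H cc Hs N.
apply: (ccvg_cmod_le (ccvgB Hs (ccvg_cst (\sum_(k < N) b k)))).
exists N => M NM; rewrite (le_trans (series_tail H NM))// lerD2r.
apply: nondecreasing_cvgn_le => //; apply: nondecreasing_series => n _ _.
exact: le_trans (cmod_ge0 _) (H n).
Qed.

Lemma ccvg_series_bounded (R : realType) (b : nat -> R[i]) (s : R[i]) :
  ccvg (fun N => \sum_(k < N) b k) s -> exists K : R, forall n, cmod (b n) <= K.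
Proof.
move=> /ccvgP /(_ 1 ltr01)[N HN].
(* The finite sum covers the indices below [N]; a later term is the difference of two partial sums
   within 1 of [s], whence the 2. *)
exists (2 + \sum_(k < N) cmod (b k)) => n; have [nN|Nn] := ltnP n N.
  rewrite (bigD1 (Ordinal nN))//= addrCA lerDl addr_ge0 ?sumr_ge0// => i _.
  exact: cmod_ge0.
rewrite ler_wpDr ?sumr_ge0//; first by move=> i _; exact: cmod_ge0.
have h1 := HN n Nn; have h2 := HN n.+1 (leqW Nn).
rewrite (_ : b n = (\sum_(k < n.+1) b k - s) - (\sum_(k < n) b k - s)).
  by rewrite (le_trans (cmodB _ _))// (_ : 2 = 1 + 1)// ltW// ltrD.
by rewrite big_ord_recr /= opprB addrA -[X in X - _]addrA addNr addr0 addrAC subrr add0r.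
Qed.

Lemma geometric_is_cvg (R : realType) (K q : R) : 0 <= q -> q < 1 ->
  cvgn (series (geometric K q)).
Proof.
move=> q0 q1; apply/cvg_ex; exists (K / (1 - q)).
by apply: cvg_geometric_series; rewrite ger0_norm.
Qed.

Lemma bernoulli_lt1 (R : realType) (r : R) k : 0 <= r -> r <= 1 ->
  1 - r ^+ k <= k%:R * (1 - r).
Proof.
move=> r0 r1; elim: k => [|k IH]; first by rewrite expr0 subrr mul0r.
have rk : r ^+ k <= 1 by rewrite exprn_ile1.
have rk0 : 0 <= r ^+ k by rewrite exprn_ge0.
rewrite exprS -natr1; nra.
Qed.

(** This is the passage [r -> 1] in Cauchy-type bounds, made explicit by Bernoulli's inequality. *)
Lemma le_pow_lt1 (R : realType) (x M : R) k : 0 <= x ->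
  (forall r, 0 <= r -> r < 1 -> x * r ^+ k <= M) -> x <= M.
Proof.
move=> x0 H; apply/ler_addgt0Pr => e e0.
(* For [r = 1 - e / D] the loss [x * (1 - r ^+ k)] is at most [x * k * e / D <= e], and [D >= e]
   keeps [r] nonnegative. *)
pose D := x * k%:R + e + 1.
have xk : 0 <= x * k%:R by rewrite mulr_ge0.
have D0 : 0 < D by rewrite /D; lra.
have r0 : 0 <= 1 - e / D by rewrite subr_ge0 ler_pdivrMr// mul1r /D; lra.
have r1 : 1 - e / D < 1 by rewrite ltrBlDr ltrDl divr_gt0.
have h := H _ r0 r1.
have b := bernoulli_lt1 k r0 (ltW r1).
have : x * k%:R * (e / D) <= e.
  by rewrite mulrCA ger_pMr// ler_pdivrMr// mul1r /D; lra.
set rk := (1 - e / D) ^+ k in h b *.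
have : x * (1 - rk) <= x * (k%:R * (1 - (1 - e / D))) by rewrite ler_wpM2l.
rewrite subKr mulrA; lra.
Qed.

(** Convergence at a radius [p] strictly between [r] and 1 bounds [a k * p ^+ k] by some [K]; for
    [|z| <= r] the series is then dominated by the geometric series of ratio [r / p]. *)
Lemma taylor_uniform (R : realType) (a : nat -> R[i]) (f : R[i] -> R[i]) (r : R) :
  taylor a f -> 0 <= r -> r < 1 -> forall e : R, 0 < e ->
  exists N, forall n z, (N <= n)%N -> cmod z <= r ->
    cmod (f z - \sum_(k < n) a k * z ^+ k) < e.
Proof.
move=> Ha r0 r1 e e0.
pose p : R := (r + 1) / 2.
have rp : r < p by rewrite /p; lra.
have p1 : p < 1 by rewrite /p; lra.
have p0 : 0 < p by exact: le_lt_trans rp.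
have pD : p%:C \in disc by apply/discP; rewrite cmod_real gtr0_norm.
have [K HK] := @ccvg_series_bounded _ (fun k => a k * p%:C ^+ k) _ (Ha _ pD).
have q1 : r / p < 1 by rewrite ltr_pdivrMr// mul1r.
have q0 : 0 <= r / p by rewrite divr_ge0// ltW.
have cc := @geometric_is_cvg _ K _ q0 q1.
have H z : cmod z <= r -> forall n, cmod (a n * z ^+ n) <= geometric K (r / p) n.
  move=> zr n; rewrite /geometric /= expr_div_n mulrA ler_pdivlMr ?exprn_gt0//.
  rewrite cmodM cmodX mulrAC ler_pM ?mulr_ge0 ?exprn_ge0 ?cmod_ge0 ?(ltW p0)//.
    by have := HK n; rewrite cmodM cmodX cmod_real gtr0_norm.
  by rewrite lerXn2r ?nnegrE ?cmod_ge0.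
have /cvgrPdist_lt/(_ e e0)[N _ HN] := cc; exists N => n z /HN /= + zr.
apply: le_lt_trans; rewrite (le_trans _ (ler_norm _))//.
apply: (abs_tail (H z zr) cc (b := fun k => a k * z ^+ k)); apply: Ha.
by apply/discP; exact: le_lt_trans r1.
Qed.

(** On the circle of radius [r] a long Taylor polynomial is bounded by [M + e], so [cauchy_poly]
    applies to it; then [e -> 0] and [r -> 1]. *)
Lemma cauchy_estimate (R : realType) (a : nat -> R[i]) (f : R[i] -> R[i]) (M : R) :
  taylor a f -> (forall z, z \in disc -> cmod (f z) <= M) ->
  forall k, cmod (a k) <= M.
Proof.
move=> Ha HM k; apply: (@le_pow_lt1 _ _ _ k); first exact: cmod_ge0.
move=> r r0 r1; apply/ler_addgt0Pr => e e0.
have [N HN] := taylor_uniform Ha r0 r1 e0.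
(* The length [2 ^ m.+1] must exceed [k], to contain the coefficient, and [N], for the uniform
   approximation. *)
pose m := maxn N k.
have mlt : (m < 2 ^ m.+1)%N by rewrite (ltn_trans (ltnSn m))// ltn_expl.
apply: (@cauchy_poly _ a m) => //; first by rewrite (leq_ltn_trans (leq_maxr N k)).
move=> z zr; rewrite -[X in cmod X](subKr (f z)).
rewrite (le_trans (cmodB _ _))// lerD//.
  by apply: HM; apply/discP; rewrite zr.
by rewrite ltW// HN ?zr// (leq_trans (leq_maxl N k))// ltnW.
Qed.

Lemma taylorB (R : realType) (a b : nat -> R[i]) (f g : R[i] -> R[i]) :
  taylor a f -> taylor b g -> taylor (fun k => a k - b k) (fsub f g).
Proof.
move=> Ha Hb z zD; rewrite (_ : (fun _ => _) = (fun N =>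
  \sum_(k < N) a k * z ^+ k - \sum_(k < N) b k * z ^+ k)).
  by apply: ccvgB; [exact: Ha|exact: Hb].
by apply/funext => N; rewrite -sumrB; apply: eq_bigr => k _; rewrite mulrBl.
Qed.

(** Cauchy's estimate with [M = 0] applies to the expansion of [f - f]. *)
Lemma taylor_unique (R : realType) (a b : nat -> R[i]) (f : R[i] -> R[i]) :
  taylor a f -> taylor b f -> a = b.
Proof.
move=> Ha Hb; apply/funext => k; apply/eqP; rewrite -subr_eq0; apply/eqP.
apply: cmod_eq0; apply/eqP; rewrite eq_le cmod_ge0 andbT.
apply: (cauchy_estimate (taylorB Ha Hb)) => z _.
by rewrite /fsub subrr cmod0.
Qed.

(** * Functions on the closed disc *)

(** Compactness of [[-M, M]] gives a cluster point of the image of [U]. It is a limit: otherwise the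
    complement of the set in question lies in [U], and clustering yields a point of that complement
    within [e] of [l]. *)
Lemma ultra_limit_real (R : realType) (U : set_system nat) (x : nat -> R) (M : R) :
  UltraFilter U -> (forall n, `|x n| <= M) ->
  exists l, forall e : R, 0 < e -> U [set n | `|x n - l| < e].
Proof.
move=> UU xM; have FF : ProperFilter (x @ U) by exact: fmap_proper_filter.
have [|l [_ Hl]] := @segment_compact R (- M) M (x @ U) FF.
  suff : U (x @^-1` `[- M, M]) by [].
  by apply: (@filterS _ U _ setT) filterT => n _; rewrite /= in_itv /= -ler_norml.
exists l => e e0.
have [//|UC] := in_ultra_setVsetC [set n | `|x n - l| < e] UU.
have [||y [yC yB]] := Hl (x @` ~` [set n | `|x n - l| < e]) (ball l e).
- suff : U (x @^-1` (x @` ~` [set n | `|x n - l| < e])) by [].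
  by apply: (@filterS _ U _ _ _ _ UC) => n Cn; exists n.
- exact: nbhsx_ballx.
case: yC yB => n Cn <-; rewrite /ball /= distrC => h.
by have := Cn h.
Qed.

Lemma ultra_limit (R : realType) (U : set_system nat) (z : nat -> R[i]) (M : R) :
  UltraFilter U -> (forall n, cmod (z n) <= M) ->
  exists l, forall e : R, 0 < e -> U [set n | cmod (z n - l) < e].
Proof.
move=> UU zM.
have [x Hx] := @ultra_limit_real _ _ (fun n => complex.Re (z n)) M UU
  (fun n => le_trans (Re_le_cmod _) (zM n)).
have [y Hy] := @ultra_limit_real _ _ (fun n => complex.Im (z n)) M UU
  (fun n => le_trans (Im_le_cmod _) (zM n)).
exists (x +i* y) => e e0; have e2 : 0 < e / 2 by rewrite divr_gt0.
apply: filterS (filterI (Hx _ e2) (Hy _ e2)) => n [/= h1 h2].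
by rewrite (le_lt_trans (cmod_le_ReIm _))// ReB ImB (splitr e) ltrD.
Qed.

(** Limits along one such [U] exist for all bounded sequences at once, and every member of [U]
    contains arbitrarily large indices. *)
Lemma free_ultrafilter : exists U : set_system nat,
  UltraFilter U /\ forall m, U [set n | (m <= n)%N].
Proof.
have [U [UU sub]] := ultraFilterLemma (eventually_filter : ProperFilter \oo).
by exists U; split => // m; apply: sub; exists m.
Qed.

Lemma ultra_limit_le (R : realType) (U : set_system nat) (z : nat -> R[i])
    (l : R[i]) (M : R) :
  UltraFilter U -> (forall n, cmod (z n) <= M) ->
  (forall e : R, 0 < e -> U [set n | cmod (z n - l) < e]) -> cmod l <= M.
Proof.
move=> UU zM Hl; apply/ler_addgt0Pr => e /Hl/filter_ex[n /= h].
rewrite -(subrKC (z n) l) (le_trans (cmodD _ _))// lerD// cmod_distC ltW//.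
Qed.

(** If [f] were unbounded, points [z n] with [|f (z n)| > n] would have a limit [l] along [U] in the
    closed disc. Continuity at [l] gives [|f (z n)| < |f l| + 1] for some [n >= |f l| + 1], a
    contradiction. *)
Lemma contCD_bounded (R : realType) (f : R[i] -> R[i]) :
  contCD f -> exists M : R, forall z, z \in cdisc -> cmod (f z) <= M.
Proof.
move=> Hc; apply: contrapT => nb.
have {}nb (n : nat) : {z | z \in cdisc & n%:R < cmod (f z)}.
  apply: cid2; apply: contrapT => nz; apply: nb; exists n%:R => z zD.
  by rewrite leNgt; apply/negP => h; apply: nz; exists z.
pose z n := s2val (nb n).
have zD n : cmod (z n) <= 1 by apply/cdiscP; exact: s2valP (nb n).
have zf n : n%:R < cmod (f (z n)) by exact: s2valP' (nb n).
have [U [UU Um]] := free_ultrafilter.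
have [l Hl] := ultra_limit UU zD.
have lD : l \in cdisc by apply/cdiscP; exact: ultra_limit_le Hl.
have [d [d0 Hd]] := Hc l lD 1 ltr01.
have [m _ Hm] := nbhs_infty_ger (cmod (f l) + 1).
have [n [/= h1 h2]] := filter_ex (filterI (Hl d d0) (Um m)).
have := Hd (z n) _ h1; rewrite (_ : z n \in cdisc); last exact/cdiscP.
move=> /(_ isT) h3; have /= h4 := Hm _ h2.
have := zf n; rewrite ltNge => /negP; apply.
rewrite -(subrKC (f l) (f (z n))) (le_trans (cmodD _ _))// (le_trans _ h4)//.
by rewrite lerD2l ltW.
Qed.

(** A point of the closed disc is approached radially by the interior points [(1 - t) * z]. *)
Lemma contCD_le (R : realType) (f : R[i] -> R[i]) (M : R) :
  contCD f -> (forall z, z \in disc -> cmod (f z) <= M) ->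
  forall z, z \in cdisc -> cmod (f z) <= M.
Proof.
move=> Hc HM z zD; apply/ler_addgt0Pr => e e0.
have [d [d0 Hd]] := Hc z zD e e0.
(* Halving gives [t < d]; the cap at 1 keeps [1 - t] nonnegative. *)
pose t : R := Num.min (d / 2) 1.
have t0 : 0 < t by rewrite lt_min divr_gt0//= ltr01.
have td : t < d by rewrite gt_min ltr_pdivrMr// mulr_natr mulr2n ltrDl d0.
have t1 : t <= 1 by rewrite ge_min lexx orbT.
have z1 : cmod z <= 1 by exact/cdiscP.
have wD : (1 - t)%:C * z \in disc.
  apply/discP; rewrite cmodM cmod_real ger0_norm ?subr_ge0//.
  by rewrite (le_lt_trans (_ : _ <= 1 - t)) ?ltrBlDr ?ltrDl// ler_piMr ?subr_ge0.
have := Hd _ (disc_cdisc wD); rewrite (_ : (1 - t)%:C * z - z = - (t%:C * z)).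
  rewrite cmodN cmodM cmod_real gtr0_norm// => h.
  rewrite -(subKr (f ((1 - t)%:C * z)) (f z)) (le_trans (cmodB _ _))// lerD ?HM//.
  by apply/ltW/h; apply: le_lt_trans td; rewrite ler_piMr// ltW.
by rewrite rmorphB rmorph1 mulrBl mul1r addrAC subrr add0r.
Qed.

Lemma contCDB (R : realType) (f g : R[i] -> R[i]) :
  contCD f -> contCD g -> contCD (fsub f g).
Proof.
move=> Hf Hg z zD e e0; have e2 : 0 < e / 2 by rewrite divr_gt0.
have [d [d0 Hd]] := Hf z zD _ e2; have [d' [d'0 Hd']] := Hg z zD _ e2.
exists (Num.min d d'); split; first by rewrite lt_min d0.
move=> w wD; rewrite lt_min => /andP[h h'].
have -> : fsub f g w - fsub f g z = (f w - f z) - (g w - g z) by rewrite /fsub; ring.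
rewrite (le_lt_trans (cmodB _ _))// (splitr e) ltrD//.
  exact: Hd.
exact: Hd'.
Qed.

(** Summable coefficients give convergence uniform on the closed disc, hence continuity up to the
    boundary. This is how [H_mu f] enters the disc algebra. *)
Lemma abs_power_series (R : realType) (b : nat -> R[i]) (c : nat -> R) :
  (forall n, cmod (b n) <= c n) -> cvgn (series c) ->
  exists g : R[i] -> R[i], [/\ taylor b g, contCD g &
    forall z, z \in cdisc -> cmod (g z) <= limn (series c)].
Proof.
move=> H cc.
have Hz z : z \in cdisc -> forall n, cmod (b n * z ^+ n) <= c n.
  move=> /cdiscP z1 n; rewrite cmodM cmodX (le_trans _ (H n))//.
  by rewrite ler_piMr ?cmod_ge0// exprn_ile1 ?cmod_ge0.
(* The membership condition sits under the existential so that choice yields a total function; 0 is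
   a default off the closed disc. *)
have ex z : exists s, z \in cdisc -> ccvg (fun N => \sum_(k < N) b k * z ^+ k) s.
  have [zD|zD] := boolP (z \in cdisc); last by exists 0.
  by have [s Hs] := abs_ccvg (Hz z zD) cc; exists s.
have {ex} [g Hg] := choice ex; exists g.
have tail z : z \in cdisc -> forall N,
    cmod (g z - \sum_(k < N) b k * z ^+ k) <= limn (series c) - series c N.
  move=> zD; exact: (abs_tail (Hz z zD) cc (b := fun k => b k * z ^+ k)) (Hg z zD).
split.
- by move=> z /disc_cdisc; exact: Hg.
- move=> z zD e e0.
  have e3 : 0 < e / 3 by rewrite divr_gt0.
  have /cvgrPdist_lt/(_ _ e3)[N _ HN] := cc.
  have {}HN w : w \in cdisc -> cmod (g w - \sum_(k < N) b k * w ^+ k) < e / 3.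
    move=> wD; rewrite (le_lt_trans (tail w wD N))// (le_lt_trans (ler_norm _))//.
    by apply: HN => /=.
  (* [L] is a Lipschitz constant of the partial sum on the closed disc, since
     [|w ^+ k - z ^+ k| <= k * |w - z|] there; the 1 makes it positive. *)
  pose L := 1 + \sum_(k < N) cmod (b k) * k%:R.
  have L0 : 0 < L.
    by rewrite ltr_pwDl// sumr_ge0// => k _; rewrite mulr_ge0 ?cmod_ge0.
  have lip w : w \in cdisc -> cmod (\sum_(k < N) b k * w ^+ k -
      \sum_(k < N) b k * z ^+ k) <= L * cmod (w - z).
    move=> wD; rewrite -sumrB (le_trans (cmod_sum _ _ _))//.
    rewrite mulrDl mul1r ler_wpDl ?cmod_ge0// mulr_suml ler_sum// => k _.
    rewrite -mulrBr cmodM -mulrA ler_wpM2l ?cmod_ge0// subrXX cmodM mulrC.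
    rewrite ler_wpM2r ?cmod_ge0// (le_trans (cmod_sum _ _ _))//.
    rewrite -[X in _ <= X%:R]card_ord -[X in _ <= X]sumr_const ler_sum// => i _.
    move: wD zD => /cdiscP wD /cdiscP zD.
    by rewrite cmodM !cmodX mulr_ile1 ?exprn_ge0 ?cmod_ge0// exprn_ile1 ?cmod_ge0.
  exists (e / 3 / L); split; first by rewrite divr_gt0.
  move=> w wD; rewrite ltr_pdivlMr// mulrC => wz.
  have h1 := HN w wD; have h2 := HN z zD; have h3 := le_lt_trans (lip w wD) wz.
  set A := \sum_(k < N) b k * w ^+ k in h1 h3.
  set B := \sum_(k < N) b k * z ^+ k in h2 h3.
  have -> : g w - g z = (g w - A) + (A - B) - (g z - B).
    by rewrite addrA subrK opprB addrA subrK.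
  have := cmodB ((g w - A) + (A - B)) (g z - B); have := cmodD (g w - A) (A - B).
  lra.
- move=> z zD; have := tail z zD 0%N.
  by rewrite big_ord0 subr0 seriesEord /= big_ord0 subr0.
Qed.

(** * Sup norms, with explicit bounds because [sup] takes a default value on unbounded sets *)

Lemma le_supD (R : realType) (f : R[i] -> R[i]) (M : R) :
  (forall z, z \in disc -> cmod (f z) <= M) ->
  forall z, z \in disc -> cmod (f z) <= supD f.
Proof.
move=> H z zD; apply: ub_le_sup; last by exists z => //; exact/set_mem.
by exists M => _ [w wD <-]; apply: H; exact/mem_set.
Qed.

Lemma supD_le (R : realType) (f : R[i] -> R[i]) (M : R) :
  (forall z, z \in disc -> cmod (f z) <= M) -> 0 <= supD f <= M.
Proof.
move=> H; rewrite (le_trans (cmod_ge0 (f 0)) (le_supD H (disc0 R))) /=.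
apply: ge_sup; first by exists (cmod (f 0)), 0 => //; exact/set_mem/disc0.
by move=> _ [z zD <-]; apply: H; exact/mem_set.
Qed.

Lemma le_supCD (R : realType) (f : R[i] -> R[i]) : contCD f ->
  forall z, z \in cdisc -> cmod (f z) <= supCD f.
Proof.
move=> /contCD_bounded[M H] z zD; apply: ub_le_sup.
  by exists M => _ [w wD <-]; apply: H; exact/mem_set.
by exists z => //; exact/set_mem.
Qed.

(** Continuity carries the bound to the boundary, so that one estimate on the open disc serves both
    norms. *)
Lemma supCD_le (R : realType) (f : R[i] -> R[i]) (M : R) : contCD f ->
  (forall z, z \in disc -> cmod (f z) <= M) -> 0 <= supCD f <= M.
Proof.
move=> Hc H; have D0 := disc_cdisc (disc0 R).
rewrite (le_trans (cmod_ge0 (f 0)) (le_supCD Hc D0)) /=.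
apply: ge_sup; first by exists (cmod (f 0)), 0 => //; exact/set_mem.
by move=> _ [z zD <-]; apply: (contCD_le Hc H); exact/mem_set.
Qed.

(** * Integration of complex functions *)

(** Dominated convergence for real-valued integrals; the limit [h] is measurable as a pointwise
    limit. *)
Lemma Rdominated_cvg d (T : measurableType d) (R : realType)
    (mu : {measure set T -> \bar R}) (D : set T) (u : nat -> T -> R) (h w : T -> R) :
  measurable D -> (forall n, mu.-integrable D (EFin \o u n)) ->
  mu.-integrable D (EFin \o w) ->
  (forall n t, D t -> `|u n t| <= w t) ->
  (forall t, D t -> (fun n => u n t) @ \oo --> h t) ->
  mu.-integrable D (EFin \o h) /\
  (fun n => Rintegral mu D (u n)) @ \oo --> Rintegral mu D h.
Proof.
move=> mD iu iw uw uh.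
have mu_ n : measurable_fun D (EFin \o u n) by have /integrableP[] := iu n.
have cE t : D t -> (EFin \o u n) t @[n --> \oo] --> (EFin \o h) t.
  by move=> Dt; apply: cvg_EFin; [exact: nearW|exact: uh].
have mh : measurable_fun D (EFin \o h).
  exact: (emeasurable_fun_cvg _ _ mu_ cE).
have uwE n t : D t -> (`|(EFin \o u n) t| <= (EFin \o w) t)%E.
  by move=> Dt; rewrite /= lee_fin uw.
have [ih _ cI] := dominated_convergence mD mu_ mh (aeW mu (fun t => cE t)) iw
  (aeW mu (fun t n => @uwE n t)).
split => //; have fin := integrable_fin_num mD ih.
by apply: fine_cvg; rewrite fineK.
Qed.

Lemma measurable_I01 (R : realType) :
  measurable (`[0%R, 1%R[%classic : set (measurableTypeR R)).
Proof. exact: measurable_itv. Qed.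

Lemma cintegralE (R : realType) (mu : Rmeas R) (h : R -> R[i]) : cintegral mu h =
  Rintegral mu `[0%R, 1%R[%classic (fun t => complex.Re (h t)) +i*
  Rintegral mu `[0%R, 1%R[%classic (fun t => complex.Im (h t)).
Proof. by rewrite /cintegral; simpc. Qed.

Lemma cdominated_cvg (R : realType) (mu : Rmeas R) (u : nat -> R -> R[i])
    (h : R -> R[i]) (w : R -> R) :
  (forall n, cintegrable mu (u n)) ->
  mu.-integrable `[0%R, 1%R[%classic (fun t => (w t)%:E) ->
  (forall n t, 0 <= t -> t < 1 -> cmod (u n t) <= w t) ->
  (forall t, 0 <= t -> t < 1 -> ccvg (fun n => u n t) (h t)) ->
  cintegrable mu h /\ ccvg (fun n => cintegral mu (u n)) (cintegral mu h).
Proof.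
move=> iu iw uw uh.
have [||ir cr] := @Rdominated_cvg _ _ _ mu _ (fun n t => complex.Re (u n t))
  (fun t => complex.Re (h t)) w (@measurable_I01 R) (fun n => (iu n).1) iw.
- move=> n t; rewrite /= in_itv /= => /andP[t0 t1].
  exact: le_trans (Re_le_cmod _) (uw n t t0 t1).
- by move=> t; rewrite /= in_itv /= => /andP[t0 t1]; have /ccvg_ReIm[] := uh t t0 t1.
have [||ii ci] := @Rdominated_cvg _ _ _ mu _ (fun n t => complex.Im (u n t))
  (fun t => complex.Im (h t)) w (@measurable_I01 R) (fun n => (iu n).2) iw.
- move=> n t; rewrite /= in_itv /= => /andP[t0 t1].
  exact: le_trans (Im_le_cmod _) (uw n t t0 t1).
- by move=> t; rewrite /= in_itv /= => /andP[t0 t1]; have /ccvg_ReIm[] := uh t t0 t1.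
split; first by split.
rewrite (funext (fun n => cintegralE mu (u n))) cintegralE.
by apply/ccvg_ReIm; split.
Qed.

Lemma cmod_cintegral_le (R : realType) (mu : Rmeas R) (h : R -> R[i]) (w : R -> R) :
  cintegrable mu h -> mu.-integrable `[0%R, 1%R[%classic (fun t => (w t)%:E) ->
  (forall t, 0 <= t -> t < 1 -> cmod (h t) <= w t) ->
  cmod (cintegral mu h) <= 2 * Rintegral mu `[0%R, 1%R[%classic w.
Proof.
move=> [ir ii] iw hw.
have aux (g : R -> R) : mu.-integrable `[0%R, 1%R[%classic (fun t => (g t)%:E) ->
    (forall t, `|g t| <= cmod (h t)) ->
    `|Rintegral mu `[0%R, 1%R[%classic g| <= Rintegral mu `[0%R, 1%R[%classic w.
  move=> ig gh; have mI := @measurable_I01 R.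
  apply: le_trans; first exact: (le_normr_Rintegral mI ig).
  apply: le_Rintegral => //; first exact: (integrable_abse ig).
  move=> t; rewrite /= in_itv /= => /andP[t0 t1].
  exact: le_trans (gh t) (hw t t0 t1).
rewrite (le_trans (cmod_le_ReIm _))// cintegralE mulrDl !mul1r lerD//.
  by apply: aux => // t; exact: Re_le_cmod.
by apply: aux => // t; exact: Im_le_cmod.
Qed.

Lemma cintegralD (R : realType) (mu : Rmeas R) (g h : R -> R[i]) :
  cintegrable mu g -> cintegrable mu h ->
  cintegrable mu (fun t => g t + h t) /\
  cintegral mu (fun t => g t + h t) = cintegral mu g + cintegral mu h.
Proof.
move=> [gr gi] [hr hi].
have mI := @measurable_I01 R.
have eR t : complex.Re (g t + h t) = complex.Re (g t) + complex.Re (h t).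
  by case: (g t); case: (h t).
have eI t : complex.Im (g t + h t) = complex.Im (g t) + complex.Im (h t).
  by case: (g t); case: (h t).
split.
  split.
    apply: eq_integrable (integrableD mI gr hr) => // t _.
    by rewrite eR EFinD.
  apply: eq_integrable (integrableD mI gi hi) => // t _.
  by rewrite eI EFinD.
rewrite !cintegralE; under eq_Rintegral do rewrite eR.
under [X in _ +i* X]eq_Rintegral do rewrite eI.
by rewrite !RintegralD.
Qed.

Lemma cintegralZ (R : realType) (mu : Rmeas R) (c : R[i]) (h : R -> R[i]) :
  cintegrable mu h -> cintegrable mu (fun t => c * h t) /\
  cintegral mu (fun t => c * h t) = c * cintegral mu h.
Proof.
move=> [hr hi]; case: c => x y.
have mI := @measurable_I01 R.
have eR t : complex.Re ((x +i* y) * h t) =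
    x * complex.Re (h t) + (- y) * complex.Im (h t).
  by case: (h t) => a b; rewrite /= mulNr.
have eI t : complex.Im ((x +i* y) * h t) =
    x * complex.Im (h t) + y * complex.Re (h t).
  by case: (h t).
have Z (k : R) (g : R -> R) : mu.-integrable `[0%R, 1%R[%classic (EFin \o g) ->
    mu.-integrable `[0%R, 1%R[%classic (EFin \o (fun t => k * g t)).
  move=> ig; apply: eq_integrable (integrableZl mI k ig) => //.
split.
  split.
    apply: eq_integrable (integrableD mI (Z x _ hr) (Z (- y) _ hi)) => // t _.
    by rewrite eR EFinD.
  apply: eq_integrable (integrableD mI (Z x _ hi) (Z y _ hr)) => // t _.
  by rewrite eI EFinD.
rewrite !cintegralE; under eq_Rintegral do rewrite eR.
under [X in _ +i* X]eq_Rintegral do rewrite eI.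
rewrite !RintegralD ?RintegralZl//; try exact: Z.
by simpc; congr (_ +i* _); rewrite ?mulNr// addrC.
Qed.

Lemma cintegral_sum (R : realType) (mu : Rmeas R) (h : nat -> R -> R[i]) (N : nat) :
  (forall n, cintegrable mu (h n)) ->
  cintegrable mu (fun t => \sum_(n < N) h n t) /\
  cintegral mu (fun t => \sum_(n < N) h n t) = \sum_(n < N) cintegral mu (h n).
Proof.
move=> ih; elim: N => [|N [IH1 IH2]].
  (* The empty sum is treated as [0 * h 0], which gives its integrability and its integral. *)
  have [] := cintegralZ 0 (ih 0%N); rewrite mul0r big_ord0.
  rewrite (_ : (fun t => 0 * h 0%N t) = (fun t => \sum_(n < 0) h n t))//.
  by apply/funext => t; rewrite mul0r big_ord0.
have [] := cintegralD IH1 (ih N); rewrite IH2 big_ord_recr /=.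
rewrite (_ : (fun t => _ + h N t) = (fun t => \sum_(n < N.+1) h n t))//.
by apply/funext => t; rewrite big_ord_recr.
Qed.

(** * Moments and the coefficients of [H_mu f] *)

Lemma integrable_exprn (R : realType) (mu : Rmeas R) n :
  mu.-integrable `[0%R, 1%R[%classic (fun t => (t ^+ n)%:E).
Proof.
have mI := @measurable_I01 R.
apply: le_integrable (finite_measure_integrable_cst mu 1 mI) => //.
  by apply/measurable_EFinP; exact: exprn_measurable.
move=> t; rewrite /= in_itv /= => /andP[t0 /ltW t1].
by rewrite lee_fin normr1 ger0_norm ?exprn_ge0// exprn_ile1.
Qed.

Lemma moment_ge0 (R : realType) (mu : Rmeas R) n : 0 <= moment mu n.
Proof.
by apply: Rintegral_ge0 => t; rewrite /= in_itv /= => /andP[t0 _]; rewrite exprn_ge0.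
Qed.

Lemma moment_EFin (R : realType) (mu : Rmeas R) n :
  (moment mu n)%:E = (\int[mu]_(t in `[0%R, 1%R[%classic) (t ^+ n)%:E)%E.
Proof.
by rewrite fineK// integrable_fin_num//; exact: integrable_exprn.
Qed.

Lemma cintegral_moment (R : realType) (mu : Rmeas R) n :
  cintegrable mu (fun t => t%:C ^+ n) /\
  cintegral mu (fun t => t%:C ^+ n) = (moment mu n)%:C.
Proof.
have e t : t%:C ^+ n = (t ^+ n)%:C :> R[i] by rewrite rmorphXn.
rewrite (funext e); split; last first.
  by rewrite cintegralE /= Rintegral_cst ?mul0r//; exact: measurable_I01.
split => /=; first exact: integrable_exprn.
exact: (finite_measure_integrable_cst mu 0 (@measurable_I01 R)).
Qed.

(** * The moment series and the integral of [1 / (1 - t)] *)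

Lemma sum_momentP (R : realType) (mu : Rmeas R) :
  (\sum_(0 <= n <oo) (moment mu n)%:E < +oo)%E <->
  exists C, forall N, series (moment mu) N <= C.
Proof.
have m0 n : (0 <= n)%N -> true -> (0 <= (moment mu n)%:E)%E.
  by move=> _ _; rewrite lee_fin moment_ge0.
split=> [fin|[C HC]].
  exists (fine (\sum_(0 <= n <oo) (moment mu n)%:E)%E) => N.
  rewrite -lee_fin fineK; last first.
    by rewrite ge0_fin_numE// nneseries_ge0// => n _ _; rewrite lee_fin moment_ge0.
  by rewrite -sumEFin; exact: nneseries_lim_ge.
rewrite (@le_lt_trans _ _ C%:E) ?ltry//.
apply: lime_le; first exact: is_cvg_nneseries.
by apply: nearW => N; rewrite sumEFin lee_fin; exact: HC.
Qed.

Lemma cvg_sum_expr (R : realType) (t : R) : 0 <= t -> t < 1 ->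
  (fun N => \sum_(k < N) t ^+ k) @ \oo --> (1 - t)^-1.
Proof.
move=> t0 t1; rewrite (_ : (fun N => _) = series (geometric 1 t)).
  by rewrite -[X in _ --> X]mul1r; apply: cvg_geometric_series; rewrite ger0_norm.
apply/funext => N; rewrite seriesEord /=.
by apply: eq_bigr => k _; rewrite mul1r.
Qed.

(** Nonnegative terms allow sum and integral to be exchanged, and the geometric series is summed
    pointwise. The equality holds in the extended reals, so it also covers the infinite case. *)
Lemma sum_moment_integral (R : realType) (mu : Rmeas R) :
  (\sum_(0 <= n <oo) (moment mu n)%:E)%E =
  (\int[mu]_(t in `[0%R, 1%R[%classic) ((1 - t)^-1)%:E)%E.
Proof.
have mI := @measurable_I01 R.
under eq_eseriesr do rewrite moment_EFin.
rewrite -(integral_nneseries mu mI).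
- apply: eq_integral => t; rewrite inE /= in_itv /= => /andP[t0 t1].
  apply: cvg_lim => //; under eq_fun do rewrite sumEFin.
  apply: cvg_EFin; first exact: nearW.
  under eq_fun do rewrite big_mkord.
  exact: cvg_sum_expr.
- by move=> n; apply/measurable_EFinP; exact: exprn_measurable.
- move=> n t; rewrite /= in_itv /= => /andP[t0 _].
  by rewrite lee_fin exprn_ge0.
Qed.

(** Measurability comes from writing [(1 - t)^-1] as a pointwise limit of polynomials on
    [[0, 1)]. *)
Lemma integrable_onem_inv (R : realType) (mu : Rmeas R) :
  (\int[mu]_(t in `[0%R, 1%R[%classic) ((1 - t)^-1)%:E < +oo)%E ->
  mu.-integrable `[0%R, 1%R[%classic (fun t => ((1 - t)^-1)%:E).
Proof.
move=> fin; have mI := @measurable_I01 R; apply/integrableP; split.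
  apply/measurable_EFinP.
  apply: (measurable_fun_cvg (h := fun N (t : R) => \sum_(k < N) t ^+ k)).
    by move=> N; apply: measurable_sum => k; exact: exprn_measurable.
  move=> t; rewrite /= in_itv /= => /andP[t0 t1].
  exact: cvg_sum_expr.
rewrite (_ : (\int[mu]_(t in _) `|_|)%E =
  (\int[mu]_(t in `[0%R, 1%R[%classic) ((1 - t)^-1)%:E)%E)//.
apply: eq_integral => t; rewrite inE /= in_itv /= => /andP[t0 t1].
by rewrite ger0_norm// invr_ge0 subr_ge0 ltW.
Qed.

Lemma sum_expr_le (R : realType) (t : R) N : 0 <= t -> t < 1 ->
  \sum_(k < N) t ^+ k <= (1 - t)^-1.
Proof.
move=> t0 t1; have t10 : 0 < 1 - t by rewrite subr_gt0.
rewrite -[leRHS]mul1r ler_pdivlMr// mulrC -opprB mulNr -subrX1 opprB.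
by rewrite gerBl exprn_ge0.
Qed.

(** It supplies the dominating function twice: for the Taylor sums of [f], and, with [c k = z ^+ k],
    for those of the kernel [1 / (1 - t * z)]. *)
Lemma cmod_sum_expr_le (R : realType) (c : nat -> R[i]) (M t : R) N :
  (forall k, cmod (c k) <= M) -> 0 <= t -> t < 1 ->
  cmod (\sum_(k < N) c k * t%:C ^+ k) <= M * (1 - t)^-1.
Proof.
move=> cM t0 t1; have M0 := le_trans (cmod_ge0 _) (cM 0%N).
apply: le_trans (ler_wpM2l M0 (sum_expr_le N t0 t1)).
rewrite (le_trans (cmod_sum _ _ _))// mulr_sumr ler_sum// => k _.
by rewrite cmodM cmodX cmod_real ger0_norm// ler_wpM2r// exprn_ge0.
Qed.

Lemma integrableZ_onem_inv (R : realType) (mu : Rmeas R) (M : R) :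
  (\int[mu]_(t in `[0%R, 1%R[%classic) ((1 - t)^-1)%:E < +oo)%E ->
  mu.-integrable `[0%R, 1%R[%classic (fun t => (M * (1 - t)^-1)%:E).
Proof.
move=> /integrable_onem_inv ig.
by apply: eq_integrable (integrableZl (@measurable_I01 R) M ig).
Qed.

Lemma real_disc (R : realType) (t : R) : 0 <= t -> t < 1 -> t%:C \in disc.
Proof. by move=> t0 t1; apply/discP; rewrite cmod_real ger0_norm. Qed.

(** The partial sums are the integrals of [t ^+ n] times the Taylor polynomials of [f], all
    dominated by [M / (1 - t)]. *)
Lemma Hmu_coefficient (R : realType) (mu : Rmeas R) (a : nat -> R[i])
    (f : R[i] -> R[i]) (M : R) (n : nat) :
  (\int[mu]_(t in `[0%R, 1%R[%classic) ((1 - t)^-1)%:E < +oo)%E ->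
  taylor a f -> (forall z, z \in disc -> cmod (f z) <= M) ->
  cintegrable mu (fun t => t%:C ^+ n * f t%:C) /\
  ccvg (fun N => \sum_(k < N) (moment mu (n + k))%:C * a k)
    (cintegral mu (fun t => t%:C ^+ n * f t%:C)).
Proof.
move=> fin Ha HM; have aM := cauchy_estimate Ha HM.
have mono k := cintegral_moment mu (n + k).
have U k := cintegralZ (a k) (mono k).1.
have S N := cintegral_sum N (fun k => (U k).1).
have [] := @cdominated_cvg _ mu _ (fun t => t%:C ^+ n * f t%:C)
  (fun t => M * (1 - t)^-1) (fun N => (S N).1).
- exact: integrableZ_onem_inv.
- move=> N t t0 t1; rewrite (_ : \sum_(k < N) _ =
      t%:C ^+ n * \sum_(k < N) a k * t%:C ^+ k).
    rewrite cmodM cmodX cmod_real ger0_norm//.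
    apply: le_trans (cmod_sum_expr_le N aM t0 t1).
    by rewrite ler_piMl ?cmod_ge0// exprn_ile1// ltW.
  by rewrite mulr_sumr; apply: eq_bigr => k _; rewrite exprD mulrCA.
- move=> t t0 t1; rewrite (_ : (fun N => _) =
      (fun N => t%:C ^+ n * \sum_(k < N) a k * t%:C ^+ k)).
    by apply: ccvgZ; apply: Ha; exact: real_disc.
  apply/funext => N; rewrite mulr_sumr; apply: eq_bigr => k _.
  by rewrite exprD mulrCA.
move=> i1 c1; split => //; move: c1.
rewrite (_ : (fun N => cintegral _ _) =
  (fun N => \sum_(k < N) (moment mu (n + k))%:C * a k))//.
apply/funext => N; rewrite (S N).2; apply: eq_bigr => k _.
by rewrite (U k).2 (mono k).2 mulrC.
Qed.

(** Once [b] is identified as an integral, [|t ^+ n * f t| <= M * t ^+ n] keeps the factor [t ^+ n],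
    hence the summable [moment mu n]. *)
Lemma Hmu_coefficient_le (R : realType) (mu : Rmeas R) (a : nat -> R[i])
    (f : R[i] -> R[i]) (M : R) (n : nat) (b : R[i]) :
  (\int[mu]_(t in `[0%R, 1%R[%classic) ((1 - t)^-1)%:E < +oo)%E ->
  taylor a f -> (forall z, z \in disc -> cmod (f z) <= M) ->
  ccvg (fun N => \sum_(k < N) (moment mu (n + k))%:C * a k) b ->
  cmod b <= 2 * M * moment mu n.
Proof.
move=> fin Ha HM Hb; have [i1 c1] := Hmu_coefficient n fin Ha HM.
rewrite (ccvg_unique Hb c1) -mulrA.
have iX := integrable_exprn mu n.
rewrite -(RintegralZl M (@measurable_I01 R) iX).
apply: cmod_cintegral_le => //.
  by apply: eq_integrable (integrableZl (@measurable_I01 R) M iX).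
move=> t t0 t1; rewrite cmodM cmodX cmod_real ger0_norm// mulrC.
by rewrite ler_wpM2r ?exprn_ge0// HM// real_disc.
Qed.

(** The series of [z ^+ n * (t ^+ n * f t)] is summed under the integral sign; its partial sums are
    dominated by [M / (1 - t)] because [|z| < 1]. *)
Lemma Hmu_eq_Imu_of_finite (R : realType) (mu : Rmeas R) :
  (\int[mu]_(t in `[0%R, 1%R[%classic) ((1 - t)^-1)%:E < +oo)%E -> Hmu_eq_Imu mu.
Proof.
move=> fin f g [_ [M HM]] [a [b [Ha Hb Hg]]] z zD; have z1 := (discP z).1 zD.
have H n := Hmu_coefficient n fin Ha HM.
have U n := cintegralZ (z ^+ n) (H n).1.
have S N := cintegral_sum N (fun n => (U n).1).
have den t : 0 <= t -> t < 1 -> cmod (t%:C * z) < 1.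
  move=> t0 t1; rewrite cmodM cmod_real ger0_norm//.
  by rewrite (le_lt_trans _ z1)// ler_piMl ?cmod_ge0// ltW.
have sE N (t : R) : \sum_(n < N) z ^+ n * (t%:C ^+ n * f t%:C) =
    f t%:C * \sum_(n < N) z ^+ n * t%:C ^+ n.
  by rewrite mulr_sumr; apply: eq_bigr => k _; rewrite mulrA mulrC.
have [] := @cdominated_cvg _ mu _ (fun t => f t%:C / (1 - t%:C * z))
  (fun t => M * (1 - t)^-1) (fun N => (S N).1).
- exact: integrableZ_onem_inv.
- move=> N t t0 t1; rewrite sE cmodM ler_pM ?cmod_ge0 ?HM ?real_disc//.
  rewrite -[leRHS]mul1r; apply: cmod_sum_expr_le => // k.
  by rewrite cmodX exprn_ile1 ?cmod_ge0// ltW.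
- move=> t t0 t1; rewrite (funext (sE ^~ t)); apply: ccvgZ.
  have d0 : 1 - t%:C * z != 0.
    apply/eqP => /eqP; rewrite subr_eq0 => /eqP e.
    by have := den t t0 t1; rewrite -e cmod1 ltxx.
  (* The finite geometric sum of [x = t * z] is [(1 - x ^+ N) / (1 - x)], and [x ^+ N] tends to
     0. *)
  rewrite (_ : (fun N => _) =
    (fun N => (1 - t%:C * z)^-1 * (1 - (t%:C * z) ^+ N))).
    rewrite -[X in ccvg _ X]mulr1; apply: ccvgZ.
    rewrite -[X in ccvg _ X]subr0; apply: ccvgB; first exact: ccvg_cst.
    apply/ccvgP => e e0; have := @cvg_expr R (cmod (t%:C * z)).
    rewrite ger0_norm ?cmod_ge0// => /(_ (den t t0 t1)).
    move=> /cvgr0Pnorm_lt/(_ e e0)[N _ HN]; exists N => k /HN /=.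
    by rewrite ger0_norm ?exprn_ge0 ?cmod_ge0// subr0 cmodX.
  apply/funext => N; apply: (mulfI d0); rewrite mulrA divff// mul1r.
  have e (x : R[i]) : 1 - x ^+ N = (1 - x) * \sum_(k < N) x ^+ k.
    by rewrite -(opprB x) mulNr -subrX1 opprB.
  rewrite e; congr (_ * _).
  by apply: eq_bigr => k _; rewrite exprMn mulrC.
move=> i1 c1; split => //.
apply: ccvg_unique (Hg z zD) _; move: c1.
rewrite (_ : (fun N => cintegral _ _) = (fun N => \sum_(k < N) b k * z ^+ k))//.
apply/funext => N; rewrite (S N).2; apply: eq_bigr => k _.
by rewrite (U k).2 mulrC (ccvg_unique (Hb k) (H k).2).
Qed.

(** * Boundedness and compactness of [H_mu] *)

(** Linearity at the level of the relation reduces continuity at [f] to a norm bound applied to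
    [fsub f' f]. *)
Lemma HmuRelB (R : realType) (mu : Rmeas R) (f f' g g' : R[i] -> R[i]) :
  HmuRel mu f g -> HmuRel mu f' g' -> HmuRel mu (fsub f' f) (fsub g' g).
Proof.
move=> [a [b [Ha Hb Hg]]] [a' [b' [Ha' Hb' Hg']]].
exists (fun k => a' k - a k), (fun k => b' k - b k).
split; [exact: taylorB| |exact: taylorB] => n.
rewrite (_ : (fun N => _) =
  (fun N => \sum_(k < N) (moment mu (n + k))%:C * a' k -
            \sum_(k < N) (moment mu (n + k))%:C * a k)).
  by apply: ccvgB; [exact: Hb'|exact: Hb].
by apply/funext => N; rewrite -sumrB; apply: eq_bigr => k _; rewrite mulrBr.
Qed.

Lemma moment_is_cvg (R : realType) (mu : Rmeas R) :
  (\int[mu]_(t in `[0%R, 1%R[%classic) ((1 - t)^-1)%:E < +oo)%E ->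
  cvgn (series (moment mu)).
Proof.
rewrite -sum_moment_integral => /sum_momentP[C HC].
apply: nondecreasing_is_cvgn; last by exists C => _ [N _ <-]; exact: HC.
by apply: nondecreasing_series => n _ _; exact: moment_ge0.
Qed.

Lemma momentZ_is_cvg (R : realType) (mu : Rmeas R) (M : R) :
  (\int[mu]_(t in `[0%R, 1%R[%classic) ((1 - t)^-1)%:E < +oo)%E ->
  cvgn (series (fun n => M * moment mu n)) /\
  limn (series (fun n => M * moment mu n)) = M * limn (series (moment mu)).
Proof.
move=> /moment_is_cvg cm.
have cM : series (fun n => M * moment mu n) @ \oo --> M * limn (series (moment mu)).
  rewrite (_ : series _ = (fun N => M * series (moment mu) N)).
    exact: cvgMr.
  by apply/funext => N; rewrite !seriesEnat /= mulr_sumr.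
by split; [apply/cvg_ex; exists (M * limn (series (moment mu)))|exact: cvg_lim].
Qed.

(** The coefficients of [g] are dominated by [2 * M * moment mu n], and [g] agrees on the disc with
    the sum [h] of that power series. *)
Lemma Hmu_le (R : realType) (mu : Rmeas R) (f g : R[i] -> R[i]) (M : R) :
  (\int[mu]_(t in `[0%R, 1%R[%classic) ((1 - t)^-1)%:E < +oo)%E ->
  HmuRel mu f g -> (forall z, z \in disc -> cmod (f z) <= M) ->
  forall z, z \in disc -> cmod (g z) <= 2 * M * limn (series (moment mu)).
Proof.
move=> fin [a [b [Ha Hb Hg]]] HM z zD.
have [c1 c2] := momentZ_is_cvg (2 * M) fin.
have bM n := Hmu_coefficient_le fin Ha HM (Hb n).
have [h [Hh _ hM]] := abs_power_series bM c1.
by rewrite -c2 (ccvg_unique (Hg z zD) (Hh z zD)) hM// disc_cdisc.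
Qed.

Lemma Hmu_exists (R : realType) (mu : Rmeas R) (f : R[i] -> R[i]) :
  (\int[mu]_(t in `[0%R, 1%R[%classic) ((1 - t)^-1)%:E < +oo)%E ->
  Hinf f -> exists g, [/\ HmuRel mu f g, Hinf g & AD g].
Proof.
move=> fin [[a Ha] [M HM]].
pose b n := cintegral mu (fun t => t%:C ^+ n * f t%:C).
have Hb n := (Hmu_coefficient n fin Ha HM).2.
have [c1 c2] := momentZ_is_cvg (2 * M) fin.
have bM n := Hmu_coefficient_le fin Ha HM (Hb n).
have [g [Hg gc gM]] := abs_power_series bM c1.
have hg : holD g by exists b.
exists g; split; [by exists a, b| |by split].
split => //; exists (limn (series (fun n => 2 * M * moment mu n))).
by move=> z /disc_cdisc/gM.
Qed.

Lemma AD_Hinf (R : realType) (f : R[i] -> R[i]) : AD f -> Hinf f.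
Proof.
move=> [hf /contCD_bounded[M HM]]; split => //.
by exists M => z /disc_cdisc/HM.
Qed.

Lemma HinfB (R : realType) (f g : R[i] -> R[i]) : Hinf f -> Hinf g -> Hinf (fsub f g).
Proof.
move=> [[a Ha] [M HM]] [[b Hb] [K HK]].
split; first by exists (fun k => a k - b k); exact: taylorB.
exists (M + K) => z zD; rewrite (le_trans (cmodB _ _))// lerD ?HM ?HK//.
Qed.

(** * The constant 1 as test function for the necessity of the integral condition *)

Lemma taylor1 (R : realType) : taylor (fun k => (k == 0%N)%:R) (fun=> 1 : R[i]).
Proof.
move=> z _; apply/ccvgP => e e0; exists 1%N => -[//|n] _.
rewrite big_ord_recl big1 ?addr0 /=; first by rewrite expr0 mulr1 subrr cmod0.
by move=> i _; rewrite mul0r.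
Qed.

Lemma AD1 (R : realType) : AD (fun=> 1 : R[i]).
Proof.
split; first by eexists; exact: taylor1.
by move=> z _ e e0; exists 1; split => // w _ _; rewrite subrr cmod0.
Qed.

Lemma Hmu1_bounded (R : realType) (mu : Rmeas R) (g : R[i] -> R[i]) :
  HmuRel mu (fun=> 1) g -> Hinf g ->
  (\int[mu]_(t in `[0%R, 1%R[%classic) ((1 - t)^-1)%:E < +oo)%E.
Proof.
move=> [a [b [Ha Hb Hg]]] [_ [M HM]].
rewrite -sum_moment_integral; apply/sum_momentP; exists M => N.
(* By uniqueness [a] is the coefficient sequence of 1, so the sums defining [b n] are constant from
   length 1 on. *)
have bE n : b n = (moment mu n)%:C.
  apply: ccvg_unique (Hb n) _; rewrite (taylor_unique Ha (@taylor1 R)).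
  apply/ccvgP => e e0; exists 1%N => -[//|K] _.
  rewrite big_ord_recl big1 ?addr0 /=; first by rewrite addn0 mulr1 subrr cmod0.
  by move=> i _; rewrite mulr0.
have s0 K : 0 <= series (moment mu) K.
  by rewrite seriesEord sumr_ge0// => k _; exact: moment_ge0.
apply: (@le_pow_lt1 _ _ _ N) => // r r0 r1.
have rD := real_disc r0 r1.
apply/ler_addgt0Pr => e e0; have /ccvgP/(_ e e0)[K HK] := Hg _ rD.
(* The length [maxn N K] is past [K], so [P] is close to [g r], and past [N], so [P] contains the
   first [N] terms, where [r ^+ k >= r ^+ N]. *)
have h := HK _ (leq_maxr N K); have := HM _ rD.
set P := \sum_(k < maxn N K) _ in h; rewrite -(subKr P (g r%:C)).
have PE : P = (\sum_(0 <= k < maxn N K) moment mu k * r ^+ k)%:C.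
  rewrite big_mkord rmorph_sum; apply: eq_bigr => k _.
  by rewrite bE rmorphM rmorphXn.
have : series (moment mu) N * r ^+ N <= cmod P.
  have t0 k : 0 <= moment mu k * r ^+ k by rewrite mulr_ge0 ?moment_ge0 ?exprn_ge0.
  rewrite PE cmod_real ger0_norm ?sumr_ge0//.
  rewrite (big_cat_nat (leq0n N) (leq_maxl N K)) /= ler_wpDr ?sumr_ge0//.
  rewrite seriesEnat /= mulr_suml ler_sum_nat// => k /andP[_ kN].
  by rewrite ler_wpM2l ?moment_ge0// ler_wiXn2l ?(ltW r1) ?(ltnW kN).
have := cmodD (P - (P - g r%:C)) (P - g r%:C); rewrite subrK.
lra.
Qed.

(** * Extraction of subsequences and compactness *)

Lemma subsequence_exists (P : nat -> nat -> Prop) :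
  (forall j m, exists k, (m <= k)%N /\ P j k) ->
  exists phi : nat -> nat, forall j, (phi j < phi j.+1)%N /\ P j (phi j).
Proof.
move=> H; have /choice[s Hs] (jm : nat * nat) :
    exists k, (jm.2 <= k)%N /\ P jm.1 k by exact: H.
(* The lower bound [(phi i).+1] forces strict growth. *)
pose phi := fix phi j := if j is i.+1 then s (j, (phi i).+1) else s (0%N, 0%N).
exists phi => j; split; first exact: (Hs (j.+1, (phi j).+1)).1.
by case: j => [|j]; [exact: (Hs (0%N, 0%N)).2|exact: (Hs (j.+1, (phi j).+1)).2].
Qed.

(* Coefficientwise limits along a free ultrafilter replace a diagonal
   extraction; the common majorant [c] controls the tails uniformly. *)
Lemma abs_power_series_compact (R : realType) (b : nat -> nat -> R[i])
    (G : nat -> R[i] -> R[i]) (c : nat -> R) :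
  (forall k n, cmod (b k n) <= c n) -> cvgn (series c) ->
  (forall k, taylor (b k) (G k)) ->
  exists (phi : nat -> nat) (g : R[i] -> R[i]),
    [/\ forall k, (phi k < phi k.+1)%N, AD g &
        forall k z, z \in disc -> cmod (G (phi k) z - g z) <= k.+1%:R^-1].
Proof.
move=> bc cc HG; have [U [UU Um]] := free_ultrafilter.
have : forall n, exists l, forall e : R, 0 < e -> U [set k | cmod (b k n - l) < e].
  by move=> n; exact: (ultra_limit UU (fun k => bc k n)).
move=> /choice[l Hl].
have lc n : cmod (l n) <= c n.
  exact: (ultra_limit_le UU (fun k => bc k n) (Hl n)).
have [g [Hg gc _]] := abs_power_series lc cc.
have head N : forall e : R, 0 < e -> U [set k | \sum_(n < N) cmod (b k n - l n) < e].
  elim: N => [|N IH] e e0.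
    by apply: (filterS _ (filterT : U setT)) => k _; rewrite /= big_ord0.
  have e2 : 0 < e / 2 by rewrite divr_gt0.
  apply: filterS (filterI (IH _ e2) (Hl N _ e2)) => k [/= h1 h2].
  by rewrite big_ord_recr /= (splitr e) ltrD.
(* Three thirds: the tails of [G k] and of [g], both controlled by [c], and the first [N]
   coefficients, controlled along [U]. *)
have unif e : 0 < e -> U [set k | forall z, z \in disc -> cmod (G k z - g z) <= e].
  move=> e0; have e3 : 0 < e / 3 by rewrite divr_gt0.
  have /cvgrPdist_lt/(_ _ e3)[N _ /(_ N (leqnn N)) HN] := cc.
  have {}HN := le_lt_trans (ler_norm _) HN.
  apply: filterS (head N _ e3) => k /= hk z zD.
  have z1 : cmod z <= 1 by rewrite ltW//; exact/discP.
  have zn n : cmod (z ^+ n) <= 1 by rewrite cmodX exprn_ile1 ?cmod_ge0.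
  have tail (d : nat -> R[i]) s : (forall n, cmod (d n) <= c n) ->
      ccvg (fun N => \sum_(n < N) d n * z ^+ n) s ->
      cmod (s - \sum_(n < N) d n * z ^+ n) < e / 3.
    move=> dc ds; apply: le_lt_trans HN.
    apply: (abs_tail (b := fun n => d n * z ^+ n)) => // n.
    by rewrite cmodM (le_trans _ (dc n))// ler_piMr ?cmod_ge0.
  have h1 := tail _ _ (bc k) (HG k z zD); have h2 := tail _ _ lc (Hg z zD).
  set A := \sum_(n < N) b k n * z ^+ n in h1; set B := \sum_(n < N) l n * z ^+ n in h2.
  have h3 : cmod (A - B) <= \sum_(n < N) cmod (b k n - l n).
    rewrite -sumrB (le_trans (cmod_sum _ _ _))// ler_sum// => n _.
    by rewrite -mulrBl cmodM ler_piMr ?cmod_ge0.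
  have -> : G k z - g z = (G k z - A) + (A - B) - (g z - B) by ring.
  have := cmodB ((G k z - A) + (A - B)) (g z - B).
  have := cmodD (G k z - A) (A - B).
  lra.
have [|phi Hphi] := @subsequence_exists (fun j k =>
    forall z, z \in disc -> cmod (G k z - g z) <= j.+1%:R^-1).
  move=> j m; have j0 : 0 < j.+1%:R^-1 :> R by rewrite invr_gt0.
  by have [k [/= h1 h2]] := filter_ex (filterI (Um m) (unif _ j0)); exists k.
exists phi, g; split.
- by move=> k; exact: (Hphi k).1.
- by split => //; exists l.
- by move=> k; exact: (Hphi k).2.
Qed.

Lemma Hmu_compact (R : realType) (mu : Rmeas R) (F G : nat -> R[i] -> R[i]) :
  (\int[mu]_(t in `[0%R, 1%R[%classic) ((1 - t)^-1)%:E < +oo)%E ->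
  (forall k, HmuRel mu (F k) (G k)) ->
  (forall k z, z \in disc -> cmod (F k z) <= 1) ->
  exists (phi : nat -> nat) (g : R[i] -> R[i]),
    [/\ forall k, (phi k < phi k.+1)%N, AD g &
        forall k z, z \in disc -> cmod (G (phi k) z - g z) <= k.+1%:R^-1].
Proof.
move=> fin H F1.
have : forall k, exists b,
    (forall n, cmod (b n) <= 2 * 1 * moment mu n) /\ taylor b (G k).
  move=> k; have [a [b [Ha Hb Hg]]] := H k; exists b; split => // n.
  exact: Hmu_coefficient_le fin Ha (F1 k) (Hb n).
move=> /choice[b Hb].
apply: (@abs_power_series_compact _ b G (fun n => 2 * 1 * moment mu n)).
- by move=> k; exact: (Hb k).1.
- exact: (momentZ_is_cvg _ fin).1.
- by move=> k; exact: (Hb k).2.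
Qed.

Lemma cvg_le_harmonic (R : realType) (u : nat -> R) :
  (forall k, 0 <= u k <= k.+1%:R^-1) -> u @ \oo --> (0 : R).
Proof.
move=> H; apply: (squeeze_cvgr _ (cvg_cst 0) (@cvg_harmonic R)).
exact: nearW.
Qed.

Lemma exists_modulus (R : realType) (S e : R) : 0 <= S -> 0 < e ->
  exists d : R, 0 < d /\ 2 * d * S < e.
Proof.
move=> S0 e0; have D0 : 0 < 2 * S + 1 by lra.
exists (e / (2 * S + 1)); split; first by rewrite divr_gt0.
(* The 1 in the denominator allows [S = 0] and makes the inequality strict. *)
rewrite mulrAC mulrA ltr_pdivrMr// mulrDr mulr1 mulrC ltrDl//.
Qed.

Theorem theorem26 (R : realType) (mu : Rmeas R)
  (supp : mu (~` `[0, 1[%classic) = 0%E) :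
  let iii := (\int[mu]_(t in `[0%R, 1%R[%classic) ((1 - t)^-1)%:E < +oo)%E in
  let iv := (\sum_(0 <= n <oo) (moment mu n)%:E < +oo)%E in
  [/\ Hmu_Hinf_cont mu <-> iii, Hmu_Hinf_compact mu <-> iii, iv <-> iii,
      Hmu_AD_cont mu <-> iii & Hmu_AD_compact mu <-> iii] /\
  (iii -> Hmu_eq_Imu mu).
Proof.
move=> iii iv; have AD1R := @AD1 R.
have S0 : iii -> 0 <= limn (series (moment mu)).
  move=> /moment_is_cvg cm; apply: limr_ge => //; apply: nearW => N.
  by rewrite seriesEord sumr_ge0// => k _; exact: moment_ge0.
split; last exact: Hmu_eq_Imu_of_finite.
(* The equivalences are taken in reverse order, each against [iii]. In the four operator statements
   [iii] follows from the image of the constant 1, which lies in both spaces. *)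
split; last first.
- split=> [[wd _]|fin].
    by have [g [Hg /AD_Hinf gH]] := wd _ AD1R; exact: Hmu1_bounded Hg gH.
  split=> [f /AD_Hinf fH|F G H].
    by have [g [? ? ?]] := Hmu_exists fin fH; exists g.
  have F1 k z : z \in disc -> cmod (F k z) <= 1.
    have [[_ Fc] F1 _ _] := H k => /disc_cdisc zD.
    exact: le_trans (le_supCD Fc zD) F1.
  have [|phi [g [mono gA le]]] := Hmu_compact fin _ F1 (G := G).
    by move=> k; have [] := H k.
  (* The rate [1 / (k + 1)] on the open disc passes to [supCD], as both functions are continuous on
     the closed disc. *)
  exists phi, g; split => //; apply: cvg_le_harmonic => k.
  apply: supCD_le (le k); apply: contCDB; last exact: gA.2.
  by have [_ _ _ []] := H (phi k).
- split=> [[wd _]|fin].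
    by have [g [Hg /AD_Hinf gH]] := wd _ AD1R; exact: Hmu1_bounded Hg gH.
  split=> [f /AD_Hinf fH|f e fA e0].
    by have [g [? ? ?]] := Hmu_exists fin fH; exists g.
  have [d [d0 dS]] := exists_modulus (S0 fin) e0; exists d; split => //.
  move=> f' g g' f'A gA g'A Hfg Hfg' fd; apply: le_lt_trans dS.
  have fc := contCDB f'A.2 fA.2.
  have fle z : z \in disc -> cmod (fsub f' f z) <= d.
    by move=> /disc_cdisc zD; exact: le_trans (le_supCD fc zD) (ltW fd).
  have gle := Hmu_le fin (HmuRelB Hfg Hfg') fle.
  by have /andP[] := supCD_le (contCDB g'A.2 gA.2) gle.
- by rewrite /iv sum_moment_integral.
- split=> [[wd _]|fin].
    by have [g [Hg gH]] := wd _ (AD_Hinf AD1R); exact: Hmu1_bounded Hg gH.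
  split=> [f fH|F G H].
    by have [g [? ? ?]] := Hmu_exists fin fH; exists g.
  have F1 k z : z \in disc -> cmod (F k z) <= 1.
    have [[_ [M FM]] F1 _] := H k => zD.
    exact: le_trans (le_supD FM zD) F1.
  have [|phi [g [mono gA le]]] := Hmu_compact fin _ F1 (G := G).
    by move=> k; have [] := H k.
  exists phi, g; split => //; first exact: AD_Hinf.
  by apply: cvg_le_harmonic => k; exact: supD_le (le k).
- split=> [[wd _]|fin].
    by have [g [Hg gH]] := wd _ (AD_Hinf AD1R); exact: Hmu1_bounded Hg gH.
  split=> [f fH|f e fH e0].
    by have [g [? ? ?]] := Hmu_exists fin fH; exists g.
  have [d [d0 dS]] := exists_modulus (S0 fin) e0; exists d; split => //.
  move=> f' g g' f'H Hfg Hfg' fd; apply: le_lt_trans dS.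
  (* The bound [M] ensures that [supD (fsub f' f)] is a genuine supremum, so [fd] bounds the
     difference pointwise. *)
  have [_ [M fM]] := HinfB f'H fH.
  have fle z : z \in disc -> cmod (fsub f' f z) <= d.
    by move=> zD; exact: le_trans (le_supD fM zD) (ltW fd).
  by have /andP[] := supD_le (Hmu_le fin (HmuRelB Hfg Hfg') fle).
Qed.
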